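(* Let $L$ be a nonabelian nilpotent Lie algebra of finite dimension $n\ge 3$ over a field $\mathbb{F}$, and assume that $L^2/Z^{\wedge}(L)$ is capable. Then $Z^{\wedge}(L\wedge L)$ is isomorphic to a subalgebra of $M(L/Z^{\wedge}(L))$.
   Context: All Lie algebras are over a prescribed field $\mathbb{F}$. For a Lie algebra $L$, $L^2=[L,L]$ is the derived subalgebra. A Lie algebra $L$ is capable if $L\cong E/Z(E)$ for some Lie algebra $E$ (with $Z(E)$ its center). The nonabelian tensor square $L\otimes L$ is the Lie algebra generated by symbols $l\otimes k$ ($l,k\in L$) subject to the relations, for $c\in\mathbb{F}$ and $l,l',k,k'\in L$: $c(l\otimes k)=cl\otimes k=l\otimes ck$; $(l+l')\otimes k=l\otimes k+l'\otimes k$; $l\otimes(k+k')=l\otimes k+l\otimes k'$; $[l,l']\otimes k=l\otimes[l',k]-l'\otimes[l,k]$; $l\otimes[k,k']=[k',l]\otimes k-[k,l]\otimes k'$; $[l\otimes k,l'\otimes k']=-[k,l]\otimes[l',k']$. The diagonal ideal is $L\square L=\langle l\otimes l\mid l\in L\rangle$, and the nonabelian exterior square is $L\wedge L=(L\otimes L)/(L\square L)$, with $l\wedge k$ denoting the image of $l\otimes k$. The Schur multiplier $M(L)$ is the second homology Lie algebra of $L$; it is identified with $\ker\kappa'$, where $\kappa':L\wedge L\to L^2$ is the epimorphism $l\wedge l'\mapsto[l,l']$. The exterior center of $L$ is $Z^{\wedge}(L)=\{l\in L\mid l\wedge l'=0 \text{ in } L\wedge L \text{ for all } l'\in L\}$,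 a central ideal of $L$. For nonabelian nilpotent $L$ of finite dimension one has $Z^{\wedge}(L)\subseteq L^2$, so the quotient $L^2/Z^{\wedge}(L)$ is defined. $Z^{\wedge}(L\wedge L)$ is the exterior center of the Lie algebra $L\wedge L$. *)

(* Defs.v *)
From HB Require Import structures.
From mathcomp Require Import all_boot all_order all_algebra.
From mathcomp Require Import boolp classical_sets.

Set Implicit Arguments.
Unset Strict Implicit.
Unset Printing Implicit Defensive.

Import GRing.Theory.

Local Open Scope ring_scope.
Local Open Scope classical_set_scope.
Local Open Scope quotient_scope.

HB.mixin Record Lmodule_isLie (F : fieldType) L of GRing.Lmodule F L := {
  bracket : L -> L -> L;
  bracketDl : forall x y z, bracket (x + y) z = bracket x z + bracket y z;
  bracketDr : forall x y z, bracket x (y + z) = bracket x y + bracket x z;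
  bracketZl : forall (a : F) x y, bracket (a *: x) y = a *: bracket x y;
  bracketZr : forall (a : F) x y, bracket x (a *: y) = a *: bracket x y;
  bracketxx : forall x, bracket x x = 0;
  jacobi : forall x y z,
    bracket x (bracket y z) + bracket y (bracket z x)
      + bracket z (bracket x y) = 0
}.

#[short(type="lieType")]
HB.structure Definition Lie (F : fieldType) :=
  {L of Lmodule_isLie F L & GRing.Lmodule F L}.

#[short(type="vectLieType")]
HB.structure Definition VectLie (F : fieldType) :=
  {L of Lmodule_isLie F L & Vector F L}.

Notation "[ 'lie' x , y ]" := (bracket x y)
  (at level 0, x, y at level 99, format "[ 'lie'  x ,  y ]") : ring_scope.

HB.mixin Record isLieMorphism (F : fieldType) (L K : lieType F) (f : L -> K) := {
  lie_morphP : {morph f : x y / [lie x, y] >-> [lie x, y]}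
}.

HB.structure Definition LieHom (F : fieldType) (L K : lieType F) :=
  {f of isLieMorphism F L K f & @GRing.Linear F L K *:%R f}.

Notation "{ 'liehom' L -> K }" := (LieHom.type L K)
  (at level 0, L at level 98, K at level 99,
   format "{ 'liehom'  L  ->  K }") : type_scope.

Definition lie_isom (F : fieldType) (L K : lieType F) : Prop :=
  exists f : {liehom L -> K}, bijective f.

Section LieTheory.
Variables (F : fieldType) (L : lieType F).
Implicit Types x y z : L.

Lemma bracket0r x : [lie x, 0] = 0.
Proof. by rewrite -(scale0r (0 : L)) bracketZr !scale0r. Qed.

Lemma bracket0l x : [lie 0, x] = 0.
Proof. by rewrite -(scale0r (0 : L)) bracketZl !scale0r. Qed.

Lemma bracketNr x y : [lie x, - y] = - [lie x, y].
Proof. by rewrite -scaleN1r bracketZr scaleN1r. Qed.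

Lemma bracketNl x y : [lie - x, y] = - [lie x, y].
Proof. by rewrite -scaleN1r bracketZl scaleN1r. Qed.

Lemma bracketC x y : [lie x, y] = - [lie y, x].
Proof.
apply/eqP; rewrite -addr_eq0; apply/eqP.
have := bracketxx (x + y).
by rewrite bracketDl !bracketDr !bracketxx add0r addr0.
Qed.

Lemma jacobil x y z : [lie [lie x, y], z] = [lie x, [lie y, z]] - [lie y, [lie x, z]].
Proof.
have /eqP := jacobi x y z.
rewrite [[lie z, [lie x, y]]]bracketC [[lie z, x]]bracketC bracketNr subr_eq0.
by move=> /eqP <-.
Qed.

Definition abelian : Prop := forall x y, [lie x, y] = 0.

End LieTheory.

Arguments abelian {F} L.

Section Subalgebras.
Variables (F : fieldType) (L : lieType F).

Definition is_subspace (A : set L) : Prop :=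
  [/\ A 0, forall x y, A x -> A y -> A (x + y) & forall (a : F) x, A x -> A (a *: x)].

Definition is_subalg (A : set L) : Prop :=
  is_subspace A /\ forall x y, A x -> A y -> A [lie x, y].

Definition is_ideal (A : set L) : Prop :=
  is_subspace A /\ forall x y, A y -> A [lie x, y].

Record subalg := Subalg { subalg_set :> L -> Prop; subalgP : is_subalg subalg_set }.
Record ideal := Ideal { ideal_set : L -> Prop; idealP : is_ideal ideal_set }.

Lemma ideal_is_subalg (I : ideal) : is_subalg (ideal_set I).
Proof. by case: I => A [sA iA]; split=> //= x y _; apply: iA. Qed.

Definition ideal_subalg (I : ideal) : subalg := Subalg (ideal_is_subalg I).
Coercion ideal_subalg : ideal >-> subalg.

Lemma smallest_subspace (G : set L) : is_subspace (smallest is_subspace G).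
Proof.
split.
- by move=> A [[]].
- by move=> x y Gx Gy A CA; have [[_ AD _] _] := CA; apply: AD; [apply: Gx|apply: Gy].
- by move=> a x Gx A CA; have [[_ _ AZ] _] := CA; apply: AZ; apply: Gx.
Qed.

Definition span (G : set L) : set L := smallest is_subspace G.

Lemma smallest_ideal (G : set L) : is_ideal (smallest is_ideal G).
Proof.
split; first split.
- by move=> A [[[]]].
- by move=> x y Gx Gy A CA; have [[[_ AD _] _] _] := CA; apply: AD; [apply: Gx|apply: Gy].
- by move=> a x Gx A CA; have [[[_ _ AZ] _] _] := CA; apply: AZ; apply: Gx.
- by move=> x y Gy A CA; have [[_ AI] _] := CA; apply: AI; apply: Gy.
Qed.

Definition ideal_gen (G : set L) : ideal := Ideal (smallest_ideal G).

Definition comm_space (A B : set L) : set L :=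
  span [set z | exists x y, [/\ A x, B y & z = [lie x, y]]].

Lemma derived_is_ideal : is_ideal (comm_space setT setT).
Proof.
split=> [|x y _]; first exact: smallest_subspace.
by apply: sub_gen_smallest; exists x, y.
Qed.

Definition derived : ideal := Ideal derived_is_ideal.

Fixpoint lower_central (k : nat) : set L :=
  if k is k'.+1 then comm_space (lower_central k') setT else setT.

Definition nilpotent : Prop := exists k, lower_central k = [set 0].

Lemma center_is_ideal : is_ideal [set x : L | forall y : L, [lie x, y] = 0].
Proof.
split; first split=> /=.
- exact: bracket0l.
- by move=> x y zx zy u; rewrite bracketDl zx zy addr0.
- by move=> a x zx u; rewrite bracketZl zx scaler0.
- by move=> x y /= zy u; rewrite [[lie x, y]]bracketC zy oppr0 bracket0l.
Qed.

Definition center : ideal := Ideal center_is_ideal.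

End Subalgebras.

Arguments derived {F} L.
Arguments lower_central {F} L k.
Arguments nilpotent {F} L.
Arguments center {F} L.

Section Kernel.
Variables (F : fieldType) (L K : lieType F) (f : {liehom L -> K}).

Lemma kernel_is_ideal : is_ideal [set x : L | f x = 0].
Proof.
split; first split=> /=.
- exact: linear0.
- by move=> x y fx fy; rewrite linearD /= fx fy addr0.
- by move=> a x fx; rewrite linearZ /= fx scaler0.
- by move=> x y /= fy; rewrite lie_morphP fy bracket0r.
Qed.

Definition kernel : ideal L := Ideal kernel_is_ideal.

End Kernel.

Section SubLie.
Variables (F : fieldType) (L : lieType F) (A : subalg L).

Definition subalg_pred : {pred L} := fun x => `[< A x >].

Lemma subalg_predP x : reflect (A x) (x \in subalg_pred).
Proof. exact: asboolP. Qed.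

Lemma subalg_submod_closed : submod_closed subalg_pred.
Proof.
have [[A0 AD AZ] _] := subalgP A.
split=> [|a x y /subalg_predP Ax /subalg_predP Ay]; apply/subalg_predP => //.
by apply: AD => //; apply: AZ.
Qed.

HB.instance Definition _ :=
  GRing.isSubmodClosed.Build F L subalg_pred subalg_submod_closed.

Definition subLie : Type := {x : L | x \in subalg_pred}.

HB.instance Definition _ := SubChoice.on subLie.
HB.instance Definition _ := [SubChoice_isSubLmodule of subLie by <:].

Lemma subLie_bracket_subproof (x y : subLie) : [lie val x, val y] \in subalg_pred.
Proof.
have [_ AB] := subalgP A.
by apply/subalg_predP/AB; apply/subalg_predP; apply: valP.
Qed.

Definition subLie_bracket (x y : subLie) : subLie :=
  Sub [lie val x, val y] (subLie_bracket_subproof x y).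

Fact subLie_bracketDl x y z :
  subLie_bracket (x + y) z = subLie_bracket x z + subLie_bracket y z.
Proof. by apply: val_inj; rewrite /= bracketDl. Qed.

Fact subLie_bracketDr x y z :
  subLie_bracket x (y + z) = subLie_bracket x y + subLie_bracket x z.
Proof. by apply: val_inj; rewrite /= bracketDr. Qed.

Fact subLie_bracketZl a x y : subLie_bracket (a *: x) y = a *: subLie_bracket x y.
Proof. by apply: val_inj; rewrite /= bracketZl. Qed.

Fact subLie_bracketZr a x y : subLie_bracket x (a *: y) = a *: subLie_bracket x y.
Proof. by apply: val_inj; rewrite /= bracketZr. Qed.

Fact subLie_bracketxx x : subLie_bracket x x = 0.
Proof. by apply: val_inj; rewrite /= bracketxx. Qed.

Fact subLie_jacobi x y z :
  subLie_bracket x (subLie_bracket y z) + subLie_bracket y (subLie_bracket z x)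
    + subLie_bracket z (subLie_bracket x y) = 0.
Proof. by apply: val_inj; rewrite /= jacobi. Qed.

HB.instance Definition _ := Lmodule_isLie.Build F subLie
  subLie_bracketDl subLie_bracketDr subLie_bracketZl subLie_bracketZr
  subLie_bracketxx subLie_jacobi.

Lemma subLie_in (x : subLie) : A (val x).
Proof. exact/subalg_predP/valP. Qed.

Definition subLie_of (x : L) (Ax : A x) : subLie :=
  Sub x (introT (subalg_predP x) Ax).

End SubLie.

(* The ideal of the Lie algebra A formed by the elements of A lying in I,
   i.e. the ideal I itself when I is contained in A. *)
Section IdealIn.
Variables (F : fieldType) (L : lieType F) (A : subalg L) (I : ideal L).

Lemma ideal_in_is_ideal : is_ideal [set x : subLie A | ideal_set I (val x)].
Proof.
have [[I0 ID IZ] IB] := idealP I.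
split; first split=> //=.
- by move=> x y; apply: ID.
- by move=> a x; apply: IZ.
- by move=> x y /=; apply: IB.
Qed.

Definition ideal_in : ideal (subLie A) := Ideal ideal_in_is_ideal.

End IdealIn.

Section QuotLie.
Variables (F : fieldType) (L : lieType F) (I : ideal L).

Definition quotLie : Type := Quotient.quot (subalg_pred I).

HB.instance Definition _ := Choice.on quotLie.
HB.instance Definition _ := EqQuotient.on quotLie.
HB.instance Definition _ := ZmodQuotient.on quotLie.

Lemma quotLieP (x y : L) :
  reflect (\pi_quotLie x = \pi_quotLie y) (x - y \in subalg_pred I).
Proof. by rewrite Quotient.idealrBE; apply: eqP. Qed.

Lemma quotLie_pi_repr (x : L) : repr (\pi_quotLie x) - x \in subalg_pred I.
Proof. by apply/quotLieP; rewrite reprK. Qed.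

Lemma quotLie_ind (P : quotLie -> Prop) :
  (forall x : L, P (\pi_quotLie x)) -> forall q, P q.
Proof. by move=> Ppi q; rewrite -[q]reprK. Qed.

Definition quotLie_scale (a : F) (q : quotLie) : quotLie := \pi_quotLie (a *: repr q).
Definition quotLie_bracket (p q : quotLie) : quotLie :=
  \pi_quotLie [lie repr p, repr q].

Lemma pi_scale a (x : L) : quotLie_scale a (\pi_quotLie x) = \pi_quotLie (a *: x).
Proof. by apply/quotLieP; rewrite -scalerBr rpredZ // quotLie_pi_repr. Qed.

Lemma pi_bracket (x y : L) :
  quotLie_bracket (\pi_quotLie x) (\pi_quotLie y) = \pi_quotLie [lie x, y].
Proof.
apply/quotLieP; set x' := repr _; set y' := repr _.
have -> : [lie x', y'] - [lie x, y] = [lie x', y' - y] - [lie y, x' - x].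
  rewrite !bracketDr !bracketNr [[lie y, x']]bracketC [[lie y, x]]bracketC.
  by rewrite opprD !opprK addrA addrNK.
have [_ IB] := idealP I.
by apply: rpredB; apply/subalg_predP; apply: IB; apply/(subalg_predP I); apply: quotLie_pi_repr.
Qed.

Lemma quotLie_piD (x y : L) : \pi_quotLie (x + y) = \pi_quotLie x + \pi_quotLie y.
Proof. exact: (@pi_addr _ _ _ _ _ (Quotient.quot (subalg_pred I))). Qed.

Lemma quotLie_pi0 : \pi_quotLie 0 = 0.
Proof. exact: (@pi_zeror _ _ _ _ _ (Quotient.quot (subalg_pred I))). Qed.

Fact quotLie_scalerA a b q : quotLie_scale a (quotLie_scale b q) = quotLie_scale (a * b) q.
Proof. by elim/quotLie_ind: q => x; rewrite !pi_scale scalerA. Qed.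

Fact quotLie_scale1r : left_id 1 quotLie_scale.
Proof. by elim/quotLie_ind => x; rewrite pi_scale scale1r. Qed.

Fact quotLie_scalerDr : right_distributive quotLie_scale +%R.
Proof.
move=> a; elim/quotLie_ind => x; elim/quotLie_ind => y.
by rewrite -quotLie_piD !pi_scale scalerDr quotLie_piD.
Qed.

Fact quotLie_scalerDl q : {morph quotLie_scale^~ q : a b / a + b}.
Proof. by elim/quotLie_ind: q => x a b; rewrite !pi_scale scalerDl quotLie_piD. Qed.

HB.instance Definition _ := GRing.Zmodule_isLmodule.Build F quotLie
  quotLie_scalerA quotLie_scale1r quotLie_scalerDr quotLie_scalerDl.

Lemma quotLie_piZ a (x : L) : \pi_quotLie (a *: x) = a *: \pi_quotLie x.
Proof. by rewrite -pi_scale. Qed.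

Fact quotLie_bracketDl p q r :
  quotLie_bracket (p + q) r = quotLie_bracket p r + quotLie_bracket q r.
Proof.
elim/quotLie_ind: p => x; elim/quotLie_ind: q => y; elim/quotLie_ind: r => z.
by rewrite -quotLie_piD !pi_bracket bracketDl quotLie_piD.
Qed.

Fact quotLie_bracketDr p q r :
  quotLie_bracket p (q + r) = quotLie_bracket p q + quotLie_bracket p r.
Proof.
elim/quotLie_ind: p => x; elim/quotLie_ind: q => y; elim/quotLie_ind: r => z.
by rewrite -quotLie_piD !pi_bracket bracketDr quotLie_piD.
Qed.

Fact quotLie_bracketZl a p q : quotLie_bracket (a *: p) q = a *: quotLie_bracket p q.
Proof.
elim/quotLie_ind: p => x; elim/quotLie_ind: q => y.
by rewrite -quotLie_piZ !pi_bracket bracketZl quotLie_piZ.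
Qed.

Fact quotLie_bracketZr a p q : quotLie_bracket p (a *: q) = a *: quotLie_bracket p q.
Proof.
elim/quotLie_ind: p => x; elim/quotLie_ind: q => y.
by rewrite -quotLie_piZ !pi_bracket bracketZr quotLie_piZ.
Qed.

Fact quotLie_bracketxx p : quotLie_bracket p p = 0.
Proof. by elim/quotLie_ind: p => x; rewrite pi_bracket bracketxx quotLie_pi0. Qed.

Fact quotLie_jacobi p q r :
  quotLie_bracket p (quotLie_bracket q r) + quotLie_bracket q (quotLie_bracket r p)
    + quotLie_bracket r (quotLie_bracket p q) = 0.
Proof.
elim/quotLie_ind: p => x; elim/quotLie_ind: q => y; elim/quotLie_ind: r => z.
by rewrite !pi_bracket -!quotLie_piD jacobi quotLie_pi0.
Qed.

HB.instance Definition _ := Lmodule_isLie.Build F quotLie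
  quotLie_bracketDl quotLie_bracketDr quotLie_bracketZl quotLie_bracketZr
  quotLie_bracketxx quotLie_jacobi.

Definition lie_coset (x : L) : quotLie := \pi_quotLie x.

Fact lie_coset_is_linear : linear lie_coset.
Proof. by move=> a x y; rewrite /lie_coset quotLie_piD quotLie_piZ. Qed.

Fact lie_coset_is_lie : {morph lie_coset : x y / [lie x, y] >-> [lie x, y]}.
Proof. by move=> x y; rewrite /lie_coset -pi_bracket. Qed.

HB.instance Definition _ := GRing.isLinear.Build F L quotLie *:%R lie_coset
  lie_coset_is_linear.
HB.instance Definition _ := isLieMorphism.Build F L quotLie lie_coset lie_coset_is_lie.

Lemma lie_coset_eq (x y : L) : lie_coset x = lie_coset y <-> ideal_set I (x - y).
Proof.
split=> [/quotLieP/subalg_predP //|Ixy].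
exact/quotLieP/subalg_predP.
Qed.

Lemma lie_coset_surj (q : quotLie) : exists x, lie_coset x = q.
Proof. by exists (repr q); rewrite /lie_coset reprK. Qed.

Section Lift.
Variables (K : lieType F) (f : {liehom L -> K}).
Hypothesis f0 : forall x, ideal_set I x -> f x = 0.

Definition quotLie_lift_fun (q : quotLie) : K := f (repr q).

Lemma quotLie_lift_funE x : quotLie_lift_fun (\pi_quotLie x) = f x.
Proof.
apply/eqP; rewrite -subr_eq0 -linearB; apply/eqP/f0.
by apply/(subalg_predP I); apply: quotLie_pi_repr.
Qed.

Fact quotLie_lift_is_linear : linear quotLie_lift_fun.
Proof.
move=> a; elim/quotLie_ind => x; elim/quotLie_ind => y.
by rewrite -quotLie_piZ -quotLie_piD !quotLie_lift_funE linearP.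
Qed.

Fact quotLie_lift_is_lie :
  {morph quotLie_lift_fun : x y / [lie x, y] >-> [lie x, y]}.
Proof.
elim/quotLie_ind => x; elim/quotLie_ind => y.
by rewrite -[[lie _, _]]/(quotLie_bracket _ _) pi_bracket !quotLie_lift_funE lie_morphP.
Qed.

HB.instance Definition _ := GRing.isLinear.Build F quotLie K *:%R quotLie_lift_fun
  quotLie_lift_is_linear.
HB.instance Definition _ := isLieMorphism.Build F quotLie K quotLie_lift_fun
  quotLie_lift_is_lie.

Definition quotLie_lift : {liehom quotLie -> K} := quotLie_lift_fun.

Lemma quotLie_liftE x : quotLie_lift (lie_coset x) = f x.
Proof. exact: quotLie_lift_funE. Qed.

End Lift.

End QuotLie.

(* Lie algebras given by generators and relations: formal Lie expressions on
   the generators, modulo the least congruence that contains the relations R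
   and the axioms of Lie algebras over F. *)
Inductive lieTerm (F X : Type) : Type :=
| LGen of X
| LZero
| LAdd of lieTerm F X & lieTerm F X
| LOpp of lieTerm F X
| LScale of F & lieTerm F X
| LBracket of lieTerm F X & lieTerm F X.

Arguments LGen {F X}.
Arguments LZero {F X}.

HB.instance Definition _ (F X : Type) := gen_eqMixin (lieTerm F X).
HB.instance Definition _ (F X : Type) := gen_choiceMixin (lieTerm F X).

Section Presentation.
Variables (F : fieldType) (X : Type) (R : lieTerm F X -> lieTerm F X -> Prop).

Inductive pres_eq : lieTerm F X -> lieTerm F X -> Prop :=
| pres_rel s t : R s t -> pres_eq s t
| pres_refl t : pres_eq t t
| pres_sym s t : pres_eq s t -> pres_eq t s
| pres_trans s t u : pres_eq s t -> pres_eq t u -> pres_eq s u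
| pres_add s s' t t' :
    pres_eq s s' -> pres_eq t t' -> pres_eq (LAdd s t) (LAdd s' t')
| pres_opp t t' : pres_eq t t' -> pres_eq (LOpp t) (LOpp t')
| pres_scale a t t' : pres_eq t t' -> pres_eq (LScale a t) (LScale a t')
| pres_bracket s s' t t' :
    pres_eq s s' -> pres_eq t t' -> pres_eq (LBracket s t) (LBracket s' t')
| pres_addA s t u : pres_eq (LAdd s (LAdd t u)) (LAdd (LAdd s t) u)
| pres_addC s t : pres_eq (LAdd s t) (LAdd t s)
| pres_add0 t : pres_eq (LAdd LZero t) t
| pres_addN t : pres_eq (LAdd (LOpp t) t) LZero
| pres_scaleA a b t : pres_eq (LScale a (LScale b t)) (LScale (a * b) t)
| pres_scale1 t : pres_eq (LScale 1 t) t
| pres_scaleDr a s t :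
    pres_eq (LScale a (LAdd s t)) (LAdd (LScale a s) (LScale a t))
| pres_scaleDl a b t :
    pres_eq (LScale (a + b) t) (LAdd (LScale a t) (LScale b t))
| pres_bracketDl s t u :
    pres_eq (LBracket (LAdd s t) u) (LAdd (LBracket s u) (LBracket t u))
| pres_bracketDr s t u :
    pres_eq (LBracket s (LAdd t u)) (LAdd (LBracket s t) (LBracket s u))
| pres_bracketZl a s t :
    pres_eq (LBracket (LScale a s) t) (LScale a (LBracket s t))
| pres_bracketZr a s t :
    pres_eq (LBracket s (LScale a t)) (LScale a (LBracket s t))
| pres_bracketxx t : pres_eq (LBracket t t) LZero
| pres_jacobi s t u :
    pres_eq (LAdd (LAdd (LBracket s (LBracket t u)) (LBracket t (LBracket u s)))
               (LBracket u (LBracket s t))) LZero.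

Definition pres_eqb : rel (lieTerm F X) := fun s t => `[< pres_eq s t >].

Lemma pres_eqb_equiv : equiv_class_of pres_eqb.
Proof.
split=> [t|s t|t s u].
- exact/asboolP/pres_refl.
- by apply/asboolP/asboolP; apply: pres_sym.
- by move=> /asboolP st /asboolP tu; apply/asboolP/(pres_trans st tu).
Qed.

Canonical pres_eqb_equivRel := EquivRelPack pres_eqb_equiv.
Canonical pres_eqb_encModRel := defaultEncModRel pres_eqb.

Definition presented : Type := {eq_quot pres_eqb}.

HB.instance Definition _ := Choice.on presented.
HB.instance Definition _ := EqQuotient.on presented.

Local Notation cl := (\pi_presented).

Lemma presentedP s t : cl s = cl t <-> pres_eq s t.
Proof.
split=> [/eqP|st]; first by rewrite eqmodE => /asboolP.
by apply/eqP; rewrite eqmodE; apply/asboolP.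
Qed.

Lemma presented_repr t : pres_eq (repr (cl t)) t.
Proof. by apply/presentedP; rewrite reprK. Qed.

Lemma presented_ind (P : presented -> Prop) : (forall t, P (cl t)) -> forall q, P q.
Proof. by move=> Pcl q; rewrite -[q]reprK. Qed.

Definition presented_add (p q : presented) : presented := cl (LAdd (repr p) (repr q)).
Definition presented_opp (p : presented) : presented := cl (LOpp (repr p)).
Definition presented_scale a (p : presented) : presented := cl (LScale a (repr p)).
Definition presented_bracket (p q : presented) : presented :=
  cl (LBracket (repr p) (repr q)).

Lemma presented_addE s t : presented_add (cl s) (cl t) = cl (LAdd s t).
Proof. by apply/presentedP/pres_add; apply: presented_repr. Qed.
Lemma presented_oppE t : presented_opp (cl t) = cl (LOpp t).
Proof. by apply/presentedP/pres_opp; apply: presented_repr. Qed.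
Lemma presented_scaleE a t : presented_scale a (cl t) = cl (LScale a t).
Proof. by apply/presentedP/pres_scale; apply: presented_repr. Qed.
Lemma presented_bracketE s t : presented_bracket (cl s) (cl t) = cl (LBracket s t).
Proof. by apply/presentedP/pres_bracket; apply: presented_repr. Qed.

Let pE :=
  (presented_addE, presented_oppE, presented_scaleE, presented_bracketE).

Fact presented_addA : associative presented_add.
Proof.
elim/presented_ind=> s; elim/presented_ind=> t; elim/presented_ind=> u.
by rewrite !pE; apply/presentedP/pres_addA.
Qed.

Fact presented_addC : commutative presented_add.
Proof.
elim/presented_ind=> s; elim/presented_ind=> t.
by rewrite !pE; apply/presentedP/pres_addC.
Qed.

Fact presented_add0 : left_id (cl LZero) presented_add.
Proof. by elim/presented_ind=> t; rewrite !pE; apply/presentedP/pres_add0. Qed.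

Fact presented_addN : left_inverse (cl LZero) presented_opp presented_add.
Proof. by elim/presented_ind=> t; rewrite !pE; apply/presentedP/pres_addN. Qed.

HB.instance Definition _ := GRing.isZmodule.Build presented
  presented_addA presented_addC presented_add0 presented_addN.

Lemma presented_piD s t : cl (LAdd s t) = cl s + cl t.
Proof. by rewrite -presented_addE. Qed.
Lemma presented_piN t : cl (LOpp t) = - cl t.
Proof. by rewrite -presented_oppE. Qed.
Lemma presented_pi0 : cl LZero = 0.
Proof. by []. Qed.

Fact presented_scalerA a b p :
  presented_scale a (presented_scale b p) = presented_scale (a * b) p.
Proof. by elim/presented_ind: p => t; rewrite !pE; apply/presentedP/pres_scaleA. Qed.

Fact presented_scale1r : left_id 1 presented_scale.
Proof. by elim/presented_ind=> t; rewrite !pE; apply/presentedP/pres_scale1. Qed.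

Fact presented_scalerDr : right_distributive presented_scale +%R.
Proof.
move=> a; elim/presented_ind=> s; elim/presented_ind=> t.
by rewrite -presented_piD !pE -presented_piD; apply/presentedP/pres_scaleDr.
Qed.

Fact presented_scalerDl p : {morph presented_scale^~ p : a b / a + b}.
Proof.
elim/presented_ind: p => t a b.
by rewrite !pE -presented_piD; apply/presentedP/pres_scaleDl.
Qed.

HB.instance Definition _ := GRing.Zmodule_isLmodule.Build F presented
  presented_scalerA presented_scale1r presented_scalerDr presented_scalerDl.

Lemma presented_piZ a t : cl (LScale a t) = a *: cl t.
Proof. by rewrite -presented_scaleE. Qed.

Fact presented_bracketDl p q r :
  presented_bracket (p + q) r = presented_bracket p r + presented_bracket q r.
Proof.
elim/presented_ind: p => s; elim/presented_ind: q => t; elim/presented_ind: r => u.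
by rewrite -presented_piD !pE -presented_piD; apply/presentedP/pres_bracketDl.
Qed.

Fact presented_bracketDr p q r :
  presented_bracket p (q + r) = presented_bracket p q + presented_bracket p r.
Proof.
elim/presented_ind: p => s; elim/presented_ind: q => t; elim/presented_ind: r => u.
by rewrite -presented_piD !pE -presented_piD; apply/presentedP/pres_bracketDr.
Qed.

Fact presented_bracketZl a p q :
  presented_bracket (a *: p) q = a *: presented_bracket p q.
Proof.
elim/presented_ind: p => s; elim/presented_ind: q => t.
by rewrite -presented_piZ !pE -presented_piZ; apply/presentedP/pres_bracketZl.
Qed.

Fact presented_bracketZr a p q :
  presented_bracket p (a *: q) = a *: presented_bracket p q.
Proof.
elim/presented_ind: p => s; elim/presented_ind: q => t.
by rewrite -presented_piZ !pE -presented_piZ; apply/presentedP/pres_bracketZr.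
Qed.

Fact presented_bracketxx p : presented_bracket p p = 0.
Proof.
by elim/presented_ind: p => t; rewrite pE -presented_pi0; apply/presentedP/pres_bracketxx.
Qed.

Fact presented_jacobi p q r :
  presented_bracket p (presented_bracket q r)
    + presented_bracket q (presented_bracket r p)
    + presented_bracket r (presented_bracket p q) = 0.
Proof.
elim/presented_ind: p => s; elim/presented_ind: q => t; elim/presented_ind: r => u.
by rewrite !pE -!presented_piD -presented_pi0; apply/presentedP/pres_jacobi.
Qed.

HB.instance Definition _ := Lmodule_isLie.Build F presented
  presented_bracketDl presented_bracketDr presented_bracketZl presented_bracketZr
  presented_bracketxx presented_jacobi.

Lemma presented_piB s t : cl (LBracket s t) = [lie cl s, cl t].
Proof. by rewrite -presented_bracketE. Qed.

Definition pres_gen (x : X) : presented := cl (LGen x).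

Section Lift.
Variables (K : lieType F) (g : X -> K).

Fixpoint lie_eval (t : lieTerm F X) : K :=
  match t with
  | LGen x => g x
  | LZero => 0
  | LAdd s t => lie_eval s + lie_eval t
  | LOpp t => - lie_eval t
  | LScale a t => a *: lie_eval t
  | LBracket s t => [lie lie_eval s, lie_eval t]
  end.

Hypothesis gR : forall s t, R s t -> lie_eval s = lie_eval t.

Lemma lie_eval_pres_eq s t : pres_eq s t -> lie_eval s = lie_eval t.
Proof.
elim=> {s t} /=.
- exact: gR.
- by [].
- by [].
- by move=> s t u _ -> _ ->.
- by move=> s s' t t' _ -> _ ->.
- by move=> t t' _ ->.
- by move=> a t t' _ ->.
- by move=> s s' t t' _ -> _ ->.
- by move=> *; rewrite addrA.
- by move=> *; rewrite addrC.
- by move=> *; rewrite add0r.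
- by move=> *; rewrite addNr.
- by move=> *; rewrite scalerA.
- by move=> *; rewrite scale1r.
- by move=> *; rewrite scalerDr.
- by move=> *; rewrite scalerDl.
- by move=> *; rewrite bracketDl.
- by move=> *; rewrite bracketDr.
- by move=> *; rewrite bracketZl.
- by move=> *; rewrite bracketZr.
- by move=> *; rewrite bracketxx.
- by move=> *; rewrite jacobi.
Qed.

Definition presented_lift_fun (p : presented) : K := lie_eval (repr p).

Lemma presented_lift_funE t : presented_lift_fun (cl t) = lie_eval t.
Proof. exact/lie_eval_pres_eq/presented_repr. Qed.

Fact presented_lift_is_linear : linear presented_lift_fun.
Proof.
move=> a; elim/presented_ind => s; elim/presented_ind => t.
by rewrite -presented_piZ -presented_piD !presented_lift_funE.
Qed.

Fact presented_lift_is_lie :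
  {morph presented_lift_fun : x y / [lie x, y] >-> [lie x, y]}.
Proof.
elim/presented_ind => s; elim/presented_ind => t.
by rewrite -presented_piB !presented_lift_funE.
Qed.

HB.instance Definition _ := GRing.isLinear.Build F presented K *:%R presented_lift_fun
  presented_lift_is_linear.
HB.instance Definition _ := isLieMorphism.Build F presented K presented_lift_fun
  presented_lift_is_lie.

Definition presented_lift : {liehom presented -> K} := presented_lift_fun.

Lemma presented_liftE x : presented_lift (pres_gen x) = g x.
Proof. exact: presented_lift_funE. Qed.

End Lift.

End Presentation.

Section TensorSquare.
Variables (F : fieldType) (L : lieType F).

Local Notation "l ** k" := (@LGen F _ (l, k)) (at level 40).

Inductive tensor_rel : lieTerm F (L * L) -> lieTerm F (L * L) -> Prop :=
| tensor_scalel c l k : tensor_rel (LScale c (l ** k)) ((c *: l) ** k)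
| tensor_scaler c l k : tensor_rel (LScale c (l ** k)) (l ** (c *: k))
| tensor_addl l l' k : tensor_rel ((l + l') ** k) (LAdd (l ** k) (l' ** k))
| tensor_addr l k k' : tensor_rel (l ** (k + k')) (LAdd (l ** k) (l ** k'))
| tensor_bracketl l l' k :
    tensor_rel ([lie l, l'] ** k) (LAdd (l ** [lie l', k]) (LOpp (l' ** [lie l, k])))
| tensor_bracketr l k k' :
    tensor_rel (l ** [lie k, k']) (LAdd ([lie k', l] ** k) (LOpp ([lie k, l] ** k')))
| tensor_bracket l k l' k' :
    tensor_rel (LBracket (l ** k) (l' ** k')) (LOpp ([lie k, l] ** [lie l', k'])).

Definition tensor_square : lieType F := presented tensor_rel.

Definition tensor (l k : L) : tensor_square := pres_gen tensor_rel (l, k).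

Definition tensor_diag : ideal tensor_square :=
  ideal_gen [set t | exists l, t = tensor l l].

Definition exterior_square : lieType F := quotLie tensor_diag.

Definition wedge (l k : L) : exterior_square := lie_coset tensor_diag (tensor l k).

Lemma bracket_in_derived (l k : L) : derived L [lie l, k].
Proof. by apply: sub_gen_smallest; exists l, k. Qed.

Definition derived_bracket (p : L * L) : subLie (derived L) :=
  subLie_of (bracket_in_derived p.1 p.2).

Lemma derived_bracket_rel s t :
  tensor_rel s t -> lie_eval derived_bracket s = lie_eval derived_bracket t.
Proof.
case=> [c l k|c l k|l l' k|l k k'|l l' k|l k k'|l k l' k']; apply: val_inj => /=.
- by rewrite bracketZl.
- by rewrite bracketZr.
- by rewrite bracketDl.
- by rewrite bracketDr.
- exact: jacobil.
- have /eqP := jacobi l k k'.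
  rewrite [[lie [lie k', l], k]]bracketC [[lie [lie k, l], k']]bracketC opprK.
  rewrite [[lie l, k]]bracketC bracketNr -addrA addr_eq0 opprD opprK.
  by move/eqP.
- by rewrite -bracketNl -bracketC.
Qed.

Definition tensor_kappa : {liehom tensor_square -> subLie (derived L)} :=
  presented_lift derived_bracket_rel.

Lemma tensor_kappa_diag t : ideal_set tensor_diag t -> tensor_kappa t = 0.
Proof.
apply: (smallest_sub (kernel_is_ideal tensor_kappa)) => {t} _ [l ->] /=.
rewrite [LHS](presented_liftE derived_bracket_rel).
by apply: val_inj; rewrite /= bracketxx.
Qed.

Definition kappa : {liehom exterior_square -> subLie (derived L)} :=
  quotLie_lift tensor_kappa_diag.

Lemma kappa_wedge (l k : L) : val (kappa (wedge l k)) = [lie l, k].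
Proof. by rewrite [kappa _](quotLie_liftE tensor_kappa_diag) [tensor_kappa _](presented_liftE derived_bracket_rel). Qed.

(* The Schur multiplier H_2(L), through its identification with ker kappa. *)
Definition schur_multiplier : ideal exterior_square := kernel kappa.

Lemma wedge_central (l : L) : (forall l', wedge l l' = 0) -> forall k, [lie l, k] = 0.
Proof. by move=> l0 k; rewrite -kappa_wedge l0 linear0. Qed.

Lemma wedge_tensor_eq (s t : lieTerm F (L * L)) : tensor_rel s t ->
  lie_coset tensor_diag (\pi_(presented tensor_rel) s) =
  lie_coset tensor_diag (\pi_(presented tensor_rel) t).
Proof. by move=> st; congr (lie_coset _ _); apply/presentedP/pres_rel. Qed.

Lemma wedgeDl l l' k : wedge (l + l') k = wedge l k + wedge l' k.
Proof. by rewrite -linearD /= -presented_piD; apply/wedge_tensor_eq/tensor_addl. Qed.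

Lemma wedgeDr l k k' : wedge l (k + k') = wedge l k + wedge l k'.
Proof. by rewrite -linearD /= -presented_piD; apply/wedge_tensor_eq/tensor_addr. Qed.

Lemma wedgeZl c l k : wedge (c *: l) k = c *: wedge l k.
Proof. by rewrite -linearZ /= -presented_piZ; apply/esym/wedge_tensor_eq/tensor_scalel. Qed.

Lemma wedgeZr c l k : wedge l (c *: k) = c *: wedge l k.
Proof. by rewrite -linearZ /= -presented_piZ; apply/esym/wedge_tensor_eq/tensor_scaler. Qed.

Lemma exterior_center_is_ideal : is_ideal [set l : L | forall l', wedge l l' = 0].
Proof.
have w0 k : wedge 0 k = 0 by rewrite -(scale0r (0 : L)) wedgeZl scale0r.
split; first split=> /=.
- exact: w0.
- by move=> x y zx zy u; rewrite wedgeDl zx zy addr0.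
- by move=> a x zx u; rewrite wedgeZl zx scaler0.
- by move=> x y /= zy u; rewrite bracketC (wedge_central zy) oppr0.
Qed.

Definition exterior_center : ideal L := Ideal exterior_center_is_ideal.

End TensorSquare.

Arguments tensor_square {F} L.
Arguments exterior_square {F} L.
Arguments exterior_center {F} L.
Arguments schur_multiplier {F} L.
Arguments kappa {F} L.

Definition capable (F : fieldType) (L : lieType F) : Prop :=
  exists E : lieType F, lie_isom L (quotLie (center E)).

(* Main.v *)
Require Import Defs.
From mathcomp Require Import all_boot all_order all_algebra.
From HB Require Import structures.
From mathcomp Require Import boolp classical_sets.

(** Write [Z] for the exterior center of [L] and [W] for [L /\ L].  Since [Z]
    wedges trivially with everything, [l /\ k] depends only on the cosets of [l]
    and [k] modulo [Z], so the projection [L -> L/Z] induces an injection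
    [phi : W -> (L/Z) /\ (L/Z)].  It remains to see that [phi] maps the exterior
    center of [W] into [M(L/Z)], the kernel of the commutator map of [L/Z]; that
    is, that the commutator map [kappa : W -> L^2] sends it into [Z].

    A surjective homomorphism maps the exterior center into the exterior center
    ([exterior_center_surj]).  For the composite [W -> L^2 -> L^2/(L^2 :&: Z)],
    the target is capable, and a capable algebra has trivial exterior center
    ([capable_exterior_center]): if [pi : E -> C] is onto with central kernel,
    then [pi x /\ pi y |-> [x, y]] is well defined, so [x] is central as soon as
    [pi x] is exterior central.  Hence [kappa] maps the exterior center of [W]
    into [Z].

    Both the injectivity of [phi] and the statement on capable algebras rest on
    one fact, [exterior_lift_along]: an exterior pairing on [E] that vanishes on
    the kernel of a surjection [E -> C] defines a homomorphism on [C /\ C]. *)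

Set Implicit Arguments.
Unset Strict Implicit.
Unset Printing Implicit Defensive.

Import GRing.Theory.

Local Open Scope ring_scope.

(** * Exterior pairings and the universal property *)

Section ExteriorPairing.
Variable F : fieldType.

(** The defining relations of the exterior square, read as conditions on a map
    of two variables. *)
Record exterior_pairing (L K : lieType F) (h : L -> L -> K) : Prop := {
  pairDl : forall l l' k, h (l + l') k = h l k + h l' k;
  pairDr : forall l k k', h l (k + k') = h l k + h l k';
  pairZl : forall c l k, h (c *: l) k = c *: h l k;
  pairZr : forall c l k, h l (c *: k) = c *: h l k;
  pair_bracketl : forall l l' k,
    h [lie l, l'] k = h l [lie l', k] - h l' [lie l, k];
  pair_bracketr : forall l k k',
    h l [lie k, k'] = h [lie k', l] k - h [lie k, l] k';
  pair_bracket : forall l k l' k',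
    [lie h l k, h l' k'] = - h [lie k, l] [lie l', k'];
  pairxx : forall l, h l l = 0
}.

Lemma pairC (L K : lieType F) (h : L -> L -> K) :
  exterior_pairing h -> forall l k, h l k = - h k l.
Proof.
move=> hP l k; apply/eqP; rewrite -addr_eq0; apply/eqP.
have := pairxx hP (l + k).
by rewrite (pairDl hP) !(pairDr hP) !(pairxx hP) add0r addr0.
Qed.

Lemma wedge_pairing (L : lieType F) : exterior_pairing (@wedge F L).
Proof.
split.
- exact: wedgeDl.
- exact: wedgeDr.
- exact: wedgeZl.
- exact: wedgeZr.
- move=> l l' k; rewrite -linearB /= -presented_piN -presented_piD.
  exact/wedge_tensor_eq/tensor_bracketl.
- move=> l k k'; rewrite -linearB /= -presented_piN -presented_piD.
  exact/wedge_tensor_eq/tensor_bracketr.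
- move=> l k l' k'; rewrite -lie_morphP -linearN /= -presented_piB -presented_piN.
  exact/wedge_tensor_eq/tensor_bracket.
- move=> l; rewrite -(linear0 (lie_coset (tensor_diag L))); apply/lie_coset_eq.
  by rewrite subr0; apply: sub_gen_smallest; exists l.
Qed.

Lemma bracket_pairing (L : lieType F) : exterior_pairing (@bracket F L).
Proof.
split.
- exact: bracketDl.
- exact: bracketDr.
- exact: bracketZl.
- exact: bracketZr.
- exact: jacobil.
- move=> l k k'; have /eqP := jacobi l k k'.
  rewrite [[lie [lie k', l], k]]bracketC [[lie [lie k, l], k']]bracketC opprK.
  rewrite [[lie l, k]]bracketC bracketNr -addrA addr_eq0 opprD opprK.
  by move/eqP.
- by move=> l k l' k'; rewrite -bracketNl -bracketC.
- exact: bracketxx.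
Qed.

Lemma hom_pairing (L M K : lieType F) (f : {liehom L -> M}) (h : M -> M -> K) :
  exterior_pairing h -> exterior_pairing (fun l k => h (f l) (f k)).
Proof.
move=> hP; split=> *; rewrite ?linearD ?linearZ ?lie_morphP /=.
- exact: (pairDl hP).
- exact: (pairDr hP).
- exact: (pairZl hP).
- exact: (pairZr hP).
- exact: (pair_bracketl hP).
- exact: (pair_bracketr hP).
- exact: (pair_bracket hP).
- exact: (pairxx hP).
Qed.

Lemma exterior_lift (L K : lieType F) (h : L -> L -> K) : exterior_pairing h ->
  exists f : {liehom exterior_square L -> K}, forall l k, f (wedge l k) = h l k.
Proof.
move=> hP; pose g (p : L * L) := h p.1 p.2.
have gR s t : tensor_rel s t -> lie_eval g s = lie_eval g t.
  case=> [c l k|c l k|l l' k|l k k'|l l' k|l k k'|l k l' k'] /=; rewrite /g /=.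
  - by rewrite (pairZl hP).
  - by rewrite (pairZr hP).
  - exact: (pairDl hP).
  - exact: (pairDr hP).
  - exact: (pair_bracketl hP).
  - exact: (pair_bracketr hP).
  - exact: (pair_bracket hP).
have f0 t : ideal_set (tensor_diag L) t -> presented_lift gR t = 0.
  apply: (smallest_sub (kernel_is_ideal (presented_lift gR))) => {t} _ [l ->] /=.
  by rewrite [LHS](presented_liftE gR) /g (pairxx hP).
exists (quotLie_lift f0) => l k.
by rewrite [LHS](quotLie_liftE f0) [LHS](presented_liftE gR).
Qed.

(** The wedges generate the exterior square as a Lie algebra. *)
Lemma exterior_subalg_ind (L : lieType F) (A : set (exterior_square L)) :
  is_subalg A -> (forall l k, A (wedge l k)) -> forall w, A w.
Proof.
move=> [[A0 AD AZ] AB] Aw; elim/quotLie_ind; elim/presented_ind.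
rewrite -/(lie_coset _ _).
elim=> [[l k]||s IHs t IHt|t IHt|a t IHt|s IHs t IHt]; rewrite -/(lie_coset _ _).
- exact: Aw.
- by rewrite presented_pi0 linear0.
- by rewrite presented_piD linearD; apply: AD.
- by rewrite presented_piN -scaleN1r linearZ; apply: AZ.
- by rewrite presented_piZ linearZ; apply: AZ.
- by rewrite presented_piB lie_morphP; apply: AB.
Qed.

(** An exterior pairing on [E] depends only on cosets modulo the kernel of [p],
    on both sides because it is alternating; evaluating it on arbitrary
    preimages gives a pairing on [C]. *)
Lemma exterior_lift_along (E C K : lieType F) (p : {liehom E -> C})
    (h : E -> E -> K) :
  (forall c, exists x, p x = c) -> exterior_pairing h ->
  (forall x y, p x = 0 -> h x y = 0) ->
  exists f : {liehom exterior_square C -> K},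
    forall x y, f (wedge (p x) (p y)) = h x y.
Proof.
move=> p_surj hP h0; have [s sK] := choice p_surj.
have hl x x' y : p x = p x' -> h x y = h x' y.
  move=> pxx'; apply/eqP; rewrite -subr_eq0 -scaleN1r -(pairZl hP) -(pairDl hP).
  by apply/eqP/h0; rewrite linearD linearZ /= scaleN1r pxx' subrr.
have hE x x' y y' : p x = p x' -> p y = p y' -> h x y = h x' y'.
  by move=> px py; rewrite (hl _ _ _ px) (pairC hP) (hl _ _ _ py) -(pairC hP).
have hsP : exterior_pairing (fun c d => h (s c) (s d)).
  (* Each relation holds in E after replacing the preimages chosen by s with
     those computed from s by the operations of E. *)
  split.
  - by move=> l l' k; rewrite -(pairDl hP); apply: hE; rewrite ?linearD /= !sK.
  - by move=> l k k'; rewrite -(pairDr hP); apply: hE; rewrite ?linearD /= !sK.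
  - by move=> a l k; rewrite -(pairZl hP); apply: hE; rewrite ?linearZ /= !sK.
  - by move=> a l k; rewrite -(pairZr hP); apply: hE; rewrite ?linearZ /= !sK.
  - move=> l l' k.
    rewrite (hE _ [lie s l, s l'] _ (s k)) ?lie_morphP ?sK // (pair_bracketl hP).
    by congr (_ - _); apply: hE; rewrite ?lie_morphP !sK.
  - move=> l k k'.
    rewrite (hE _ (s l) _ [lie s k, s k']) ?lie_morphP ?sK // (pair_bracketr hP).
    by congr (_ - _); apply: hE; rewrite ?lie_morphP !sK.
  - move=> l k l' k'; rewrite (pair_bracket hP).
    by congr (- _); apply: hE; rewrite ?lie_morphP !sK.
  - by move=> l; apply: (pairxx hP).
have [f fE] := exterior_lift hsP.
by exists f => x y; rewrite fE; apply: hE; rewrite sK.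
Qed.

End ExteriorPairing.

(** * The exterior center *)

Section ExteriorCenter.
Variable F : fieldType.

(** Functoriality: [x /\ y |-> f x /\ f y] is a homomorphism, and every element
    of [K] is some [f y]. *)
Lemma exterior_center_surj (L K : lieType F) (f : {liehom L -> K}) :
  (forall y, exists x, f x = y) ->
  forall x, exterior_center L x -> exterior_center K (f x).
Proof.
move=> f_surj x x0 y'; have [y <-] := f_surj y'.
have [g gE] := exterior_lift (hom_pairing f (wedge_pairing K)).
by rewrite -gE x0 linear0.
Qed.

(** For [C = E/Z(E)], the bracket of [E] factors through [C /\ C]; hence a lift
    to [E] of an exterior central element of [C] is central. *)
Lemma capable_exterior_center (C : lieType F) :
  capable C -> forall c, exterior_center C c -> c = 0.
Proof.
move=> [E [f [g fK gK]]] c c0.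
pose D : lieType F := quotLie (center E).
have fc0 : exterior_center D (f c).
  by apply: exterior_center_surj => // d; exists (g d).
have [x xE] := lie_coset_surj (f c).
have [h hE] : exists h : {liehom exterior_square D -> E},
    forall x y, h (wedge (lie_coset (center E) x) (lie_coset (center E) y))
                = [lie x, y].
  apply: exterior_lift_along; [exact: lie_coset_surj|exact: bracket_pairing|].
  move=> y z; rewrite -(linear0 (lie_coset (center E))) => /lie_coset_eq.
  by rewrite subr0; apply.
apply: (can_inj fK); rewrite linear0 -xE -(linear0 (lie_coset (center E))).
apply/lie_coset_eq; rewrite subr0 => y.
by rewrite -hE [lie_coset _ x]xE fc0 linear0.
Qed.

Lemma kappa_surj (L : lieType F) (d : subLie (derived L)) :
  exists w, kappa L w = d.
Proof.
suff /(_ _ (subLie_in d)) [w wE] :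
    forall x, derived L x -> exists w, val (kappa L w) = x.
  by exists w; apply: val_inj.
apply: smallest_sub => [|_ [x [y [_ _ ->]]]]; last first.
  by exists (wedge x y); rewrite kappa_wedge.
split.
- by exists 0; rewrite linear0.
- by move=> _ _ [u <-] [v <-]; exists (u + v); rewrite linearD.
- by move=> a _ [u <-]; exists (a *: u); rewrite linearZ.
Qed.

(** Capability of [L^2/(L^2 :&: Z)] enters here: the exterior center of [L /\ L]
    dies in that quotient. *)
Lemma kappa_exterior_center (L : lieType F) :
  capable (quotLie (ideal_in (derived L) (exterior_center L))) ->
  forall w, exterior_center (exterior_square L) w ->
    exterior_center L (val (kappa L w)).
Proof.
move=> capL w w0; set I := ideal_in _ _ in capL.
have kw0 : exterior_center _ (kappa L w).
  by apply: exterior_center_surj => //; apply: kappa_surj.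
have : lie_coset I (kappa L w) = 0.
  apply: (capable_exterior_center capL).
  by apply: exterior_center_surj => //; apply: lie_coset_surj.
by rewrite -(linear0 (lie_coset I)) => /lie_coset_eq; rewrite subr0.
Qed.

Lemma wedge_map_kappa (L K : lieType F) (f : {liehom L -> K})
    (g : {liehom exterior_square L -> exterior_square K}) :
  (forall l k, g (wedge l k) = wedge (f l) (f k)) ->
  forall w, val (kappa K (g w)) = f (val (kappa L w)).
Proof.
move=> gE; apply: exterior_subalg_ind; last first.
  by move=> l k; rewrite gE !kappa_wedge lie_morphP.
split; first split.
- by rewrite !linear0.
- by move=> u v uE vE; rewrite !linearD /= uE vE.
- by move=> a u uE; rewrite !linearZ /= uE.
- by move=> u v uE vE; rewrite !lie_morphP /= uE vE -lie_morphP.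
Qed.

(** The left inverse is [pi x /\ pi y |-> x /\ y], well defined because [Z] wedges
    trivially with [L]. *)
Lemma exterior_square_mod_center (L : lieType F) :
  let Z := exterior_center L in
  exists2 g : {liehom exterior_square L -> exterior_square (quotLie Z)},
    forall l k, g (wedge l k) = wedge (lie_coset Z l) (lie_coset Z k)
    & injective g.
Proof.
move=> Z.
have [g gE] := exterior_lift (hom_pairing (lie_coset Z) (wedge_pairing _)).
exists g => //.
have [h hE] : exists h : {liehom exterior_square (quotLie Z) -> exterior_square L},
    forall x y, h (wedge (lie_coset Z x) (lie_coset Z y)) = wedge x y.
  apply: exterior_lift_along; [exact: lie_coset_surj|exact: wedge_pairing|].
  move=> x y; rewrite -(linear0 (lie_coset Z)) => /lie_coset_eq.
  by rewrite subr0; apply.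
apply: (can_inj (g := h)); apply: exterior_subalg_ind; last first.
  by move=> l k; rewrite gE hE.
split; first split.
- by rewrite !linear0.
- by move=> u v uE vE; rewrite !linearD /= uE vE.
- by move=> a u uE; rewrite !linearZ /= uE.
- by move=> u v uE vE; rewrite !lie_morphP uE vE.
Qed.

End ExteriorCenter.

(** * Restricting an injective homomorphism to subalgebras *)

Section Restriction.
Variables (F : fieldType) (L K : lieType F) (f : {liehom L -> K}).
Variables (A : subalg L) (B : subalg K).
Hypothesis fAB : forall x, A x -> B (f x).

Lemma restr_image_is_subalg :
  is_subalg [set y : subLie B | exists2 x, A x & f x = val y].
Proof.
have [[A0 AD AZ] AB] := subalgP A.
split; first split=> /=.
- by exists 0 => //; rewrite linear0.
- move=> y y' [x Ax xE] [x' Ax' xE']; exists (x + x'); first exact: AD.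
  by rewrite linearD /= xE xE'.
- move=> a y [x Ax xE]; exists (a *: x); first exact: AZ.
  by rewrite linearZ /= xE.
- move=> y y' [x Ax xE] [x' Ax' xE']; exists [lie x, x']; first exact: AB.
  by rewrite lie_morphP xE xE'.
Qed.

Definition restr_image : subalg (subLie B) := Subalg restr_image_is_subalg.

Lemma restr_in_image (x : subLie A) :
  restr_image (subLie_of (fAB (subLie_in x))).
Proof. by exists (val x) => //; apply: subLie_in. Qed.

Definition restr_fun (x : subLie A) : subLie restr_image :=
  subLie_of (restr_in_image x).

Fact restr_is_linear : linear restr_fun.
Proof. by move=> a x y; do 2!apply: val_inj; rewrite /= linearP. Qed.

Fact restr_is_lie : {morph restr_fun : x y / [lie x, y] >-> [lie x, y]}.
Proof. by move=> x y; do 2!apply: val_inj; rewrite /= lie_morphP. Qed.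

HB.instance Definition _ := GRing.isLinear.Build F (subLie A) (subLie restr_image)
  *:%R restr_fun restr_is_linear.
HB.instance Definition _ := isLieMorphism.Build F (subLie A) (subLie restr_image)
  restr_fun restr_is_lie.

Lemma inj_restr_isom : injective f -> lie_isom (subLie A) (subLie restr_image).
Proof.
move=> f_inj; exists restr_fun.
have preim y : exists x, restr_fun x = y.
  have [x Ax xE] := subLie_in y.
  by exists (subLie_of Ax); do 2!apply: val_inj.
have [g gK] := choice preim.
exists g => // x; apply/val_inj/f_inj.
by have /(congr1 val)/(congr1 val) := gK (restr_fun x).
Qed.

End Restriction.

Theorem theorem1p2 (F : fieldType) (L : vectLieType F) (n : nat)
    (dimL : \dim {: L} = n) (n_ge3 : (3 <= n)%N)
    (nonabL : ~ abelian L) (nilL : nilpotent L)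
    (capL : capable (quotLie (ideal_in (derived L) (exterior_center L)))) :
  exists S : subalg (subLie (schur_multiplier (quotLie (exterior_center L)))),
    lie_isom (subLie (exterior_center (exterior_square L))) (subLie S).
Proof.
have [g gE g_inj] := exterior_square_mod_center L.
have gAB w : exterior_center (exterior_square L) w ->
    schur_multiplier (quotLie (exterior_center L)) (g w).
  move=> w0; apply: val_inj; rewrite (wedge_map_kappa gE) /=.
  rewrite -(linear0 (lie_coset (exterior_center L))); apply/lie_coset_eq.
  by rewrite subr0; apply: kappa_exterior_center.
exists (restr_image g (exterior_center (exterior_square L))
         (schur_multiplier (quotLie (exterior_center L)))).
exact: (inj_restr_isom gAB).
Qed.
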